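(* Let $A$ be an Artin algebra with ADR algebra $R=R_A=\operatorname{End}_A(G)^{op}$, let $M$ be a (finitely generated left) $A$-module, and let $j\geq 1$ be an integer. Then, as submodules of the $R$-module $\operatorname{Hom}_A(G,M)$, \[ \operatorname{Hom}_A(G,\operatorname{Soc}_j M)=\operatorname{Tr}\Big(\bigoplus_{(k,l)\in\Lambda:\, l\leq j}P_{k,l},\ \operatorname{Hom}_A(G,M)\Big). \] Moreover, if $\operatorname{Soc}_j M/\operatorname{Soc}_{j-1}M\cong\bigoplus_{\theta\in\Theta}L_{x_\theta}$ with $x_\theta\in\{1,\dots,n\}$, then \[ \operatorname{Hom}_A(G,\operatorname{Soc}_j M)/\operatorname{Hom}_A(G,\operatorname{Soc}_{j-1}M)\cong\bigoplus_{\theta\in\Theta}\Delta(x_\theta,j). \]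
   Context: All modules are finitely generated left modules. Let $A$ be an Artin algebra, $\{P_1,\dots,P_n\}$ a complete set of pairwise non-isomorphic projective indecomposable $A$-modules, $L_i$ the simple top of $P_i$, and $l_i$ the Loewy length of $P_i$. Put $G=\bigoplus_{i=1}^n\bigoplus_{j=1}^{l_i}P_i/\operatorname{Rad}^jP_i$. The ADR algebra of $A$ is $R=R_A=\operatorname{End}_A(G)^{op}$; for an $A$-module $M$, $\operatorname{Hom}_A(G,M)$ is a left $R$-module. The projective indecomposable $R$-modules are $P_{i,j}=\operatorname{Hom}_A(G,P_i/\operatorname{Rad}^jP_i)$, for $(i,j)\in\Lambda=\{(i,j):1\leq i\leq n,\ 1\leq j\leq l_i\}$. Let $L_{i,j}$ be the simple top of $P_{i,j}$. The set $\Lambda$ is partially ordered by $(i,j)\lhd(k,l)\Leftrightarrow j>l$ (so $(i,j)\unlhd(k,l)$ means $(i,j)=(k,l)$ or $j>l$). For modules $X,M$, the trace $\operatorname{Tr}(X,M)$ is the sum of the images of all homomorphisms $X\to M$. The standard $R$-modules are $\Delta(i,j)=P_{i,j}/\operatorname{Tr}\big(\bigoplus_{(k,l)\not\unlhd(i,j)}P_{k,l},P_{i,j}\big)$, i.e. the largest quotient of $P_{i,j}$ all of whose composition factors are of the form $L_{k,l}$ with $(k,l)\unlhd(i,j)$. The socle series is $\operatorname{Soc}_0M=0$, $\operatorname{Soc}_{j}M/\operatorname{Soc}_{j-1}M=\operatorname{Soc}(M/\operatorname{Soc}_{j-1}M)$. For $M_1\subseteq M_2$, $\operatorname{Hom}_A(G,M_1)$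 is regarded as a submodule of $\operatorname{Hom}_A(G,M_2)$. *)

(* Defs.v *)
From HB Require Import structures.
From mathcomp Require Import all_boot all_order all_algebra.
From mathcomp Require Import boolp.

Set Implicit Arguments.
Unset Strict Implicit.
Unset Printing Implicit Defensive.

Import GRing.Theory.

Local Open Scope ring_scope.
Local Open Scope quotient_scope.

(* Modules are [lmodType]s and submodules of M are terms of
   [submodClosed M]; these carry boolean predicates, so submodules given by
   propositions go through [`[< _ >]].  Submodules are compared with [=i]. *)

Section Submodules.
Variables (R : pzRingType) (M : lmodType R).

Definition mk_submod (S : {pred M}) (clS : submod_closed S) :
    submodClosed M :=
  HB.pack S (GRing.isSubmodClosed.Build R M S (GRing.submod_closed_semi clS)).

Lemma zero_submod_closed : submod_closed (pred1 (0 : M)).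
Proof.
split=> [|a x y]; rewrite !inE //.
by move=> /eqP -> /eqP ->; rewrite scaler0 addr0.
Qed.

Definition zero_submod := mk_submod zero_submod_closed.

Lemma full_submod_closed : submod_closed (predT : {pred M}).
Proof. by []. Qed.

Definition full_submod := mk_submod full_submod_closed.

Lemma sum_submod_closed (F : submodClosed M -> Prop) :
  submod_closed (fun x => `[< exists m (N : 'I_m -> submodClosed M)
      (y : 'I_m -> M), (forall i, F (N i) /\ y i \in N i) /\
      x = \sum_(i < m) y i >]).
Proof.
split.
  apply/asboolP; exists 0%N, (fun=> zero_submod), (fun=> 0).
  by split; [case | rewrite big_ord0].
move=> a u v /asboolP[m [N [y [Ny ->]]]] /asboolP[p [K [z [Kz ->]]]].
apply/asboolP; exists (m + p)%N.
exists (fun i => match split i with inl i1 => N i1 | inr i2 => K i2 end).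
exists (fun i => match split i with inl i1 => a *: y i1 | inr i2 => z i2 end).
split=> [i|].
  case: (split i) => [i1|i2] //; have [FN yN] := Ny i1.
  by split => //; apply: rpredZ.
rewrite big_split_ord scaler_sumr /=; congr (_ + _); apply: eq_bigr => i _.
  by case: split_ordP => i1; [move/lshift_inj-> | move/eqP; rewrite eq_lrshift].
by case: split_ordP => i1; [move/eqP; rewrite eq_rlshift | move/rshift_inj->].
Qed.

Definition sum_submod F := mk_submod (sum_submod_closed F).

Definition simple_submod (S : submodClosed M) :=
  ~ (S =i zero_submod) /\
  forall K : submodClosed M, {subset K <= S} -> K =i zero_submod \/ K =i S.

Definition soc := sum_submod simple_submod.

Definition maximal_submod (N K : submodClosed M) :=
  [/\ {subset K <= N}, ~ (K =i N) &
      forall L : submodClosed M,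
        {subset K <= L} -> {subset L <= N} -> L =i K \/ L =i N].

Lemma rad_submod_closed (N : submodClosed M) :
  submod_closed (fun x => (x \in N) &&
    `[< forall K, maximal_submod N K -> x \in K >]).
Proof.
split.
  apply/andP; split; first exact: rpred0.
  by apply/asboolP => K _; apply: rpred0.
move=> a u v /andP[uN /asboolP uK] /andP[vN /asboolP vK]; apply/andP; split.
  by apply: rpredD => //; apply: rpredZ.
by apply/asboolP => K mK; apply: rpredD; [apply/rpredZ/uK | apply: vK].
Qed.

(* The radical is that of N as a module, viewed inside M, so that its
   iterates starting from M are the Rad^j M. *)
Definition rad_submod N := mk_submod (rad_submod_closed N).

Definition radn (j : nat) := iter j rad_submod full_submod.

Definition is_loewy_length (m : nat) :=
  radn m =i zero_submod /\ forall p, radn p =i zero_submod -> (m <= p)%N.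

Definition fin_gen :=
  exists m (v : 'I_m -> M), forall x, exists c : 'I_m -> R,
    x = \sum_(i < m) c i *: v i.

Definition indecomposable :=
  (exists x : M, x != 0) /\
  forall N K : submodClosed M,
    (forall x, x \in N -> x \in K -> x = 0) ->
    (forall x, exists u v, [/\ u \in N, v \in K & x = u + v]) ->
    N =i zero_submod \/ K =i zero_submod.

End Submodules.

Arguments zero_submod {R M}.
Arguments full_submod {R M}.
Arguments radn {R} M j.
Arguments soc {R} M.

Section SubmoduleType.
Variables (R : pzRingType) (M : lmodType R) (N : submodClosed M).

Record submod : Type := Submod { submod_val : M; _ : submod_val \in N }.

HB.instance Definition _ := [isSub for submod_val].
HB.instance Definition _ := [Choice of submod by <:].
HB.instance Definition _ := GRing.SubChoice_isSubLmodule.Build R M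
  (fun x => x \in N) submod
  (GRing.submod_closed_semi (GRing.submodClosedP N)).

Definition incl : {linear submod -> M} := val : submod -> M.

End SubmoduleType.

Section QuotientModule.
Variables (R : pzRingType) (M : lmodType R) (N : submodClosed M).

(* [submodClosed] carries no closure under opposite, which the quotient
   construction of the library requires. *)
Definition zmod_of_submod : zmodClosed M :=
  HB.pack (GRing.SubmodClosed.sort N) (GRing.isZmodClosed.Build M
    (GRing.SubmodClosed.sort N)
    (GRing.submod_closedB (GRing.submodClosedP N))).

Definition quo : Type := {ideal_quot zmod_of_submod}.

HB.instance Definition _ := GRing.Zmodule.on quo.
HB.instance Definition _ := EqQuotient.on quo.

Definition quo_scale (a : R) (q : quo) : quo := \pi_quo (a *: repr q).

Lemma quo_eqP (x y : M) : (\pi_quo x == \pi_quo y) = (x - y \in N).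
Proof. exact: esym (Quotient.idealrBE zmod_of_submod x y). Qed.

Lemma quo_piD (x y : M) : \pi_quo (x + y) = \pi_quo x + \pi_quo y.
Proof. exact (Quotient.pi_add zmod_of_submod x y). Qed.

Lemma quo_scale_pi a x : quo_scale a (\pi_quo x) = \pi_quo (a *: x).
Proof.
apply/eqP; rewrite quo_eqP -scalerBr; apply: rpredZ.
by rewrite -quo_eqP reprK.
Qed.

Lemma quo_scaleA a b q : quo_scale a (quo_scale b q) = quo_scale (a * b) q.
Proof. by rewrite [quo_scale b q]/quo_scale quo_scale_pi scalerA. Qed.

Lemma quo_scale1 : left_id 1 quo_scale.
Proof. by move=> q; rewrite -[q]reprK quo_scale_pi scale1r. Qed.

Lemma quo_scaleDr : right_distributive quo_scale +%R.
Proof.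
move=> a p q; rewrite -{1}[p]reprK -{1}[q]reprK -quo_piD quo_scale_pi.
by rewrite scalerDr quo_piD.
Qed.

Lemma quo_scaleDl q : {morph quo_scale^~ q : a b / a + b}.
Proof.
by move=> a b; rewrite -[q]reprK !quo_scale_pi scalerDl quo_piD.
Qed.

HB.instance Definition _ := GRing.Zmodule_isLmodule.Build R quo
  quo_scaleA quo_scale1 quo_scaleDr quo_scaleDl.

Definition quo_map (x : M) : quo := \pi_quo x.

Lemma quo_map_linear : linear quo_map.
Proof. by move=> a x y; rewrite /quo_map quo_piD -quo_scale_pi. Qed.

HB.instance Definition _ := GRing.isLinear.Build R M quo *:%R quo_map
  quo_map_linear.

End QuotientModule.

Section ImagePreimage.
Variables (R : pzRingType) (U V : lmodType R) (f : {linear U -> V}).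

Lemma im_submod_closed : submod_closed (fun y => `[< exists x, y = f x >]).
Proof.
split; first by apply/asboolP; exists 0; rewrite linear0.
move=> a u v /asboolP[x ->] /asboolP[y ->].
by apply/asboolP; exists (a *: x + y); rewrite linearP.
Qed.

Definition im_submod := mk_submod im_submod_closed.

Lemma preim_submod_closed (N : submodClosed V) :
  submod_closed (fun x => f x \in N).
Proof.
split; first by rewrite unfold_in linear0; apply: rpred0.
move=> a u v uN vN; rewrite unfold_in linearP.
by apply: rpredD => //; apply: rpredZ.
Qed.

Definition preim_submod N := mk_submod (preim_submod_closed N).

End ImagePreimage.

Section MoreModules.
Variables (R : pzRingType).
Implicit Types (X Y : lmodType R).

Definition iso X Y := exists f : {linear X -> Y}, bijective f.

(* N / K for submodules K <= N of M; K is pulled back to the module N. *)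
Definition subquo (M : lmodType R) (N K : @submodClosed R M) : lmodType R :=
  quo (preim_submod (incl N) K).

Definition top X : lmodType R := quo (radn X 1).

Fixpoint socn (M : lmodType R) j : @submodClosed R M :=
  if j is i.+1 then preim_submod (quo_map (socn M i)) (soc (quo (socn M i)))
  else zero_submod.

Definition trace (X M : lmodType R) : submodClosed M :=
  sum_submod (fun N => exists f : {linear X -> M}, N = im_submod f).

Definition projective X :=
  forall (Y Z : lmodType R) (g : {linear Y -> Z}) (f : {linear X -> Z}),
    (forall z, exists y, g y = z) ->
    exists h : {linear X -> Y}, forall x, g (h x) = f x.

Definition complete_proj_indec n (P : 'I_n -> lmodType R) :=
  [/\ forall i, [/\ fin_gen (P i), projective (P i) & indecomposable (P i)],
      forall i j, iso (P i) (P j) -> i = j &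
      forall X, fin_gen X -> projective X -> indecomposable X ->
        exists i, iso X (P i)].

End MoreModules.

Definition artinian (k : pzRingType) :=
  forall I : nat -> submodClosed k^o,
    (forall m, {subset I m.+1 <= I m}) ->
    exists m, forall p, (m <= p)%N -> I p =i I m.

Definition artin_algebra (k : comNzRingType) (A : algType k) :=
  artinian k /\ fin_gen (A : lmodType k).

Section DirectSum.
Variables (R : pzRingType) (I : finType) (X : I -> lmodType R).

Definition dsum : Type := forall i, X i.

HB.instance Definition _ := Choice.on dsum.

Implicit Types u v w : dsum.

Lemma dsumP u v : (forall i, u i = v i) -> u = v.
Proof. exact: functional_extensionality_dep. Qed.

Definition dsum_add u v : dsum := fun i => u i + v i.
Definition dsum_opp u : dsum := fun i => - u i.
Definition dsum_zero : dsum := fun=> 0.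
Definition dsum_scale a u : dsum := fun i => a *: u i.

Lemma dsum_addA : associative dsum_add.
Proof. by move=> u v w; apply: dsumP => i; apply: addrA. Qed.

Lemma dsum_addC : commutative dsum_add.
Proof. by move=> u v; apply: dsumP => i; apply: addrC. Qed.

Lemma dsum_add0 : left_id dsum_zero dsum_add.
Proof. by move=> u; apply: dsumP => i; apply: add0r. Qed.

Lemma dsum_addN : left_inverse dsum_zero dsum_opp dsum_add.
Proof. by move=> u; apply: dsumP => i; apply: addNr. Qed.

HB.instance Definition _ := GRing.isZmodule.Build dsum
  dsum_addA dsum_addC dsum_add0 dsum_addN.

Lemma dsum_scaleA a b u : dsum_scale a (dsum_scale b u) = dsum_scale (a * b) u.
Proof. by apply: dsumP => i; apply: scalerA. Qed.

Lemma dsum_scale1 : left_id 1 dsum_scale.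
Proof. by move=> u; apply: dsumP => i; apply: scale1r. Qed.

Lemma dsum_scaleDr : right_distributive dsum_scale +%R.
Proof.
by move=> a u v; apply: dsumP => i; apply: scalerDr.
Qed.

Lemma dsum_scaleDl u : {morph dsum_scale^~ u : a b / a + b}.
Proof.
by move=> a b; apply: dsumP => i; apply: scalerDl.
Qed.

HB.instance Definition _ := GRing.Zmodule_isLmodule.Build R dsum
  dsum_scaleA dsum_scale1 dsum_scaleDr dsum_scaleDl.

End DirectSum.

Section LHom.
Variables (R : pzRingType) (U V : lmodType R).

Definition LHom : Type := {linear U -> V}.

HB.instance Definition _ := gen_eqMixin LHom.
HB.instance Definition _ := gen_choiceMixin LHom.

Implicit Types f g h : LHom.

Lemma LHomP f g : f =1 g -> f = g.
Proof.
case: f g => [f cf] [g cg] /= /funext efg; case: _ / efg in cg *.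
congr GRing.Linear.Pack; case: cf cg => [[f1] [f2]] [[g1] [g2]].
by congr GRing.Linear.Class; [congr Algebra.isNmodMorphism.Axioms_ |
  congr GRing.isScalable.Axioms_]; apply: Prop_irrelevance.
Qed.

Definition LHom_add f g : LHom := f \+ g.
Definition LHom_opp f : LHom := \- f.
Definition LHom_zero : LHom := \0.

Lemma LHom_addA : associative LHom_add.
Proof. by move=> f g h; apply: LHomP => x; apply: addrA. Qed.

Lemma LHom_addC : commutative LHom_add.
Proof. by move=> f g; apply: LHomP => x; apply: addrC. Qed.

Lemma LHom_add0 : left_id LHom_zero LHom_add.
Proof. by move=> f; apply: LHomP => x; apply: add0r. Qed.

Lemma LHom_addN : left_inverse LHom_zero LHom_opp LHom_add.
Proof. by move=> f; apply: LHomP => x; apply: addNr. Qed.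

HB.instance Definition _ := GRing.isZmodule.Build LHom
  LHom_addA LHom_addC LHom_add0 LHom_addN.

End LHom.

Section EndomorphismRing.
Variables (R : pzRingType) (U : lmodType R).

Definition Endo : Type := LHom U U.

HB.instance Definition _ := GRing.Zmodule.on Endo.

Implicit Types f g h : Endo.

Definition Endo_one : Endo := idfun.
Definition Endo_mul f g : Endo := f \o g.

Lemma Endo_mulA : associative Endo_mul.
Proof. by move=> f g h; apply: LHomP. Qed.

Lemma Endo_mul1l : left_id Endo_one Endo_mul.
Proof. by move=> f; apply: LHomP. Qed.

Lemma Endo_mul1r : right_id Endo_one Endo_mul.
Proof. by move=> f; apply: LHomP. Qed.

Lemma Endo_mulDl : left_distributive Endo_mul +%R.
Proof. by move=> f g h; apply: LHomP. Qed.

Lemma Endo_mulDr : right_distributive Endo_mul +%R.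
Proof. by move=> f g h; apply: LHomP => x; apply: (linearD f). Qed.

HB.instance Definition _ := GRing.Zmodule_isPzRing.Build Endo
  Endo_mulA Endo_mul1l Endo_mul1r Endo_mulDl Endo_mulDr.

End EndomorphismRing.

(* Hom(U, V) is a left module over End(U)^op, with r *: f = f \o r. *)
Section HomModule.
Variables (R : pzRingType) (U V : lmodType R).

Definition LHom_scale (r : (Endo U)^c) (f : LHom U V) : LHom U V :=
  f \o (r : Endo U).

Lemma LHom_scaleA r s f : LHom_scale r (LHom_scale s f) = LHom_scale (r * s) f.
Proof. by apply: LHomP. Qed.

Lemma LHom_scale1 : left_id 1 LHom_scale.
Proof. by move=> f; apply: LHomP. Qed.

Lemma LHom_scaleDr : right_distributive LHom_scale +%R.
Proof. by move=> r f g; apply: LHomP. Qed.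

Lemma LHom_scaleDl f : {morph LHom_scale^~ f : r s / r + s}.
Proof. by move=> r s; apply: LHomP => x; apply: (linearD f). Qed.

HB.instance Definition _ := GRing.Zmodule_isLmodule.Build (Endo U)^c (LHom U V)
  LHom_scaleA LHom_scale1 LHom_scaleDr LHom_scaleDl.

End HomModule.

Section HomFunctor.
Variables (R : pzRingType) (U V W : lmodType R) (u : {linear V -> W}).

Definition LHom_map (f : LHom U V) : LHom U W := u \o f.

Lemma LHom_map_linear : linear LHom_map.
Proof. by move=> r f g; apply: LHomP => x; apply: (linearD u). Qed.

HB.instance Definition _ := GRing.isLinear.Build (Endo U)^c (LHom U V) (LHom U W)
  *:%R LHom_map LHom_map_linear.

End HomFunctor.

(* Hom(U, N) regarded as a submodule of Hom(U, V), for N a submodule of V *)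
Definition LHom_submod (R : pzRingType) (U V : lmodType R)
    (N : submodClosed V) : submodClosed (LHom U V) :=
  im_submod (@LHom_map R U _ _ (incl N)).

Section ADR.
Variables (A : pzRingType) (n : nat) (P : 'I_n -> lmodType A) (l : 'I_n -> nat).

(* Ordinals start at 0: the pair (i, j) with 1 <= j <= l i is encoded with
   second component j - 1, and [level] recovers j. *)
Definition Lam : Type := {i : 'I_n & 'I_(l i)}.

HB.instance Definition _ := Finite.on Lam.

Definition level (p : Lam) : nat := (tagged p).+1.

Definition lam_le (p q : Lam) : bool := (p == q) || (level q < level p)%N.

Definition quo_rad (p : Lam) : lmodType A :=
  quo (radn (P (tag p)) (level p)).

Definition Gmod : lmodType A := dsum quo_rad.

Definition ADR : pzRingType := (Endo Gmod)^c.

Definition HomG (M : lmodType A) : lmodType ADR := LHom Gmod M.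

Definition PR (p : Lam) : lmodType ADR := HomG (quo_rad p).

Definition Delta (p : Lam) : lmodType ADR :=
  quo (trace (dsum (fun q : {q : Lam | ~~ lam_le q p} => PR (val q))) (PR p)).

End ADR.

(* Main.v *)
Require Import Defs.
From HB Require Import structures.
From mathcomp Require Import all_boot all_order all_algebra.
From mathcomp Require Import boolp.
From mathcomp Require classical_sets.

Set Implicit Arguments.
Unset Strict Implicit.
Unset Printing Implicit Defensive.

Import GRing.Theory.

Local Open Scope ring_scope.

(* A map f from a projective P_i to V lands in Soc_j V iff it kills Rad^j P_i,
   so the maps from G into Soc_j V are exactly those that factor, summand by
   summand, through quotients P_k / Rad^l P_k with l <= j; by Yoneda this is the
   trace.  For the second claim, each simple summand top(P_x) of the j-th socle
   layer is hit by a map P_x -> Soc_j V, which factors through P_x / Rad^j P_x.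
   Together these give a surjection from the direct sum of the P_{x,j} onto
   Hom(G, Soc_j V) / Hom(G, Soc_{j-1} V), with kernel the direct sum of the
   Hom(G, Rad P_x / Rad^j P_x).  This is also the kernel of the projection onto
   the sum of the Delta(x, j): P_x is local, so a map P_k / Rad^l P_k ->
   P_x / Rad^j P_x not landing in the radical lifts to a split surjection
   P_k -> P_x, which forces k = x and l >= j. *)

(** * Submodule lattice, maximal submodules and the radical of the socle *)

Section SubmoduleTheory.
Variables (R : pzRingType) (M : lmodType R).
Implicit Types N K L S T : submodClosed M.

Lemma in_zero_submod (x : M) : (x \in @zero_submod R M) = (x == 0).
Proof. by []. Qed.

Lemma submodB N x y : x \in N -> y \in N -> x - y \in N.
Proof. by move=> xN yN; rewrite rpredD// -scaleN1r rpredZ. Qed.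

Lemma submodN N x : x \in N -> - x \in N.
Proof. by move=> xN; rewrite -scaleN1r rpredZ. Qed.

Lemma cap_submod_closed N K : submod_closed [predI N & K].
Proof.
split=> [|a u v]; rewrite !inE ?rpred0//.
by move=> /andP[uN uK] /andP[vN vK]; rewrite !rpredD ?rpredZ.
Qed.

Definition cap_submod N K := mk_submod (cap_submod_closed N K).

Lemma in_cap_submod N K x : (x \in cap_submod N K) = (x \in N) && (x \in K).
Proof. by []. Qed.

Lemma add_submod_closed N K : submod_closed
  (fun x => `[< exists u v, [/\ u \in N, v \in K & x = u + v] >]).
Proof.
split.
  by apply/asboolP; exists 0, 0; rewrite !rpred0 addr0.
move=> a _ _ /asboolP[u [v [uN vK ->]]] /asboolP[u' [v' [uN' vK' ->]]].
apply/asboolP; exists (a *: u + u'), (a *: v + v').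
by rewrite !rpredD ?rpredZ// scalerDr addrACA.
Qed.

Definition add_submod N K := mk_submod (add_submod_closed N K).

Lemma add_submodP N K x :
  reflect (exists u v, [/\ u \in N, v \in K & x = u + v])
          (x \in add_submod N K).
Proof. exact: asboolP. Qed.

Lemma mem_add_submodl N K x : x \in N -> x \in add_submod N K.
Proof. by move=> xN; apply/add_submodP; exists x, 0; rewrite rpred0 addr0. Qed.

Lemma mem_add_submodr N K x : x \in K -> x \in add_submod N K.
Proof. by move=> xK; apply/add_submodP; exists 0, x; rewrite rpred0 add0r. Qed.

Lemma add_submod_sub N K L :
  {subset N <= L} -> {subset K <= L} -> {subset add_submod N K <= L}.
Proof.
by move=> NL KL x /add_submodP[u [v [/NL uL /KL vL ->]]]; rewrite rpredD.
Qed.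

Lemma sum_submod_sub (F : submodClosed M -> Prop) N :
  (forall K, F K -> {subset K <= N}) -> {subset sum_submod F <= N}.
Proof.
move=> FN x /asboolP[m [K [y [Ky ->]]]]; apply: rpred_sum => i _.
by have [FK yK] := Ky i; apply: FN yK.
Qed.

Lemma mem_sum_submod (F : submodClosed M -> Prop) K :
  F K -> {subset K <= sum_submod F}.
Proof.
move=> FK x xK; apply/asboolP.
by exists 1%N, (fun=> K), (fun=> x); rewrite big_ord1.
Qed.

Lemma simple_sub_soc S : simple_submod S -> {subset S <= soc M}.
Proof. exact: mem_sum_submod. Qed.

Lemma simple_cap0 S N : simple_submod S -> ~ {subset S <= N} ->
  forall x, x \in S -> x \in N -> x = 0.
Proof.
move=> [_ simS] SN x xS xN.
have [|cap0|capS] := simS (cap_submod S N).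
- by move=> y; rewrite in_cap_submod => /andP[].
- by have := cap0 x; rewrite in_cap_submod xS xN in_zero_submod => /esym/eqP.
- by case: SN => y; rewrite -capS in_cap_submod => /andP[].
Qed.

Lemma radP N x :
  reflect (x \in N /\ forall K, maximal_submod N K -> x \in K)
          (x \in rad_submod N).
Proof.
by apply: (iffP andP) => -[xN] => [/asboolP|xK]; split=> //; apply/asboolP.
Qed.

Lemma rad_sub N : {subset rad_submod N <= N}.
Proof. by move=> x /radP[]. Qed.

Lemma iter_rad_sub N i : {subset iter i (@rad_submod R M) N <= N}.
Proof. by elim: i => // i IHi x /rad_sub/IHi. Qed.

Lemma radn_sub i j : (i <= j)%N -> {subset radn M j <= radn M i}.
Proof. by move=> /subnK <-; rewrite /radn iterD; apply: iter_rad_sub. Qed.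

Lemma maximal_add N K T : maximal_submod N K -> {subset T <= N} ->
  ~ {subset T <= K} -> forall x, x \in N -> x \in add_submod T K.
Proof.
move=> [KN _ maxK] TN TK x xN.
have [||eqK|eqN] := maxK (add_submod T K).
- by move=> y; apply: mem_add_submodr.
- exact: add_submod_sub.
- by case: TK => y yT; rewrite -eqK mem_add_submodl.
- by rewrite eqN.
Qed.

(** Zorn's lemma on the submodules of [N] that avoid [x]; it supplies the maximal submodules needed
    in [rad_soc]. *)
Lemma exists_submod_avoiding (x : M) N : x \in N -> x != 0 ->
  exists K, [/\ {subset K <= N}, x \notin K &
   forall L, {subset K <= L} -> {subset L <= N} -> x \notin L -> L =i K].
Proof.
move=> xN x0.
pose T := {K : submodClosed M | {subset K <= N} /\ x \notin K}.
pose mkT K (KP : {subset K <= N} /\ x \notin K) : T := exist _ K KP.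
have t0P : {subset @zero_submod R M <= N} /\ x \notin @zero_submod R M.
  by split=> // y; rewrite in_zero_submod => /eqP->; rewrite rpred0.
pose le (K L : T) := `[< {subset sval K <= sval L} >].
have [|K L J /asboolP KL /asboolP LJ|F totF|[K [KN xK]] maxK] :=
    @classical_sets.ZL_preorder T (mkT _ t0P) le.
- by move=> K; apply/asboolP.
- by apply/asboolP => y /KL/LJ.
(* The zero submodule bounds the empty chain. Any other chain is bounded by its union, which is
   closed under addition because two members are always comparable. *)
- have [[K0 FK0]|F0] := pselect (exists K0 : T, F K0); last first.
    by exists (mkT _ t0P) => s Fs; case: F0; exists s.
  have clU : submod_closed (fun y => `[< exists2 K : T, F K & y \in sval K >]).
    split=> [|a u v /asboolP[K FK uK] /asboolP[L FL vL]].
      by apply/asboolP; exists K0 => //; apply: rpred0.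
    apply/asboolP; have [/asboolP KL|/asboolP LK] := totF K L FK FL.
      by exists L => //; apply: rpredD vL; apply/rpredZ/KL.
    by exists K => //; apply: rpredD; [apply: rpredZ|apply: LK].
  have UP : {subset mk_submod clU <= N} /\ x \notin mk_submod clU.
    split=> [y /asboolP[K _]|]; first by case: K => K [KN _] /= /KN.
    by apply/asboolP => -[[K [_ xK]] _ /=]; apply/negP.
  by exists (mkT _ UP) => K FK; apply/asboolP => y yK; apply/asboolP; exists K.
- exists K; split=> // L KL LN xL y.
  have := maxK (mkT L (conj LN xL)); rewrite /classical_sets.premaximal /=.
  move=> /(_ (asboolT KL))/asboolP LK.
  by apply/idP/idP => [/LK|/KL].
Qed.

(** For [x != 0] in the socle, a submodule [K] of the socle that is maximal among those avoiding [x]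
    turns out to be a maximal submodule, so [x] is outside the radical. *)
Lemma rad_soc x : x \in rad_submod (soc M) -> x = 0.
Proof.
move=> /radP[xS xK]; apply/eqP/contraT => x0.
have [K [KS xNK maxK]] := exists_submod_avoiding xS x0.
suff: x \in K by rewrite (negPf xNK).
apply: xK; split=> // [eqK|L KL LS].
  by rewrite eqK xS in xNK.
have [xL|xL] := boolP (x \in L); last by left; apply: maxK.
right=> y; apply/idP/idP => [/LS//|]; move: y; apply: sum_submod_sub => T simT.
have [//|TL] := pselect {subset T <= L}.
have TS := simple_sub_soc simT.
have TK : ~ {subset T <= K} by move=> TK; apply: TL => y /TK/KL.
(* If [T + K] avoids [x], it equals [K] by the choice of [K], against [T] not lying in [K]. It does
   avoid [x]: from [x = u + v], the element [u = x - v] lies in both [T] and [L], hence is 0, and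
   [x] would be in [K]. *)
have xTK : x \notin add_submod T K; last first.
  case: TK => y yT; have <- // := maxK (add_submod T K).
  - exact: mem_add_submodl.
  - by move=> z; apply: mem_add_submodr.
  - exact: add_submod_sub.
apply: contra xNK => /add_submodP[u [v [uT vK def_x]]].
have u0 : u = 0.
  apply: (simple_cap0 simT TL uT); rewrite -(addrK v u) -def_x.
  by apply: submodB => //; apply: KL.
by rewrite def_x u0 add0r.
Qed.


End SubmoduleTheory.

(** * Descending chain condition for finitely generated modules over an Artin algebra *)

Section DescendingChains.

(** The chain condition in its minimal-element form, which the later arguments use directly. *)
Definition dcc (R : pzRingType) (M : lmodType R) :=
  forall F : submodClosed M -> Prop, (exists N, F N) ->
  exists2 N, F N & forall K, F K -> {subset K <= N} -> {subset N <= K}.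

Lemma dcc_of_chains (R : pzRingType) (M : lmodType R) :
  (forall I : nat -> submodClosed M, (forall m, {subset I m.+1 <= I m}) ->
     exists m, forall p, (m <= p)%N -> {subset I m <= I p}) ->
  dcc M.
Proof.
move=> chains F [N0 FN0]; apply: contrapT => noMin.
pose T := {N : submodClosed M | F N}.
have next (t : T) : exists u : T, {subset sval u <= sval t} /\
    ~ {subset sval t <= sval u}.
  case: t => N FN; apply: contrapT => noK; case: noMin; exists N => // K FK KN.
  apply: contrapT => NK; case: noK.
  by exists (exist (fun N : submodClosed M => F N) K FK).
have [f fP] := choice next.
pose t0 : T := exist (fun N : submodClosed M => F N) N0 FN0.
have [m|m /(_ m.+1 (leqnSn m))] := chains (fun m => sval (iter m f t0)).
  by have [] := fP (iter m f t0).
by have [_] := fP (iter m f t0).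
Qed.

Variables (k : pzRingType) (A : pzRingType) (phi : {rmorphism k -> A}).
Variable M : lmodType A.

(** The [k]-span of [s], with [k] acting through [phi]. The recursion isolates the coefficient of
    the first generator. *)
Fixpoint span (s : seq M) (x : M) : Prop :=
  if s is w :: s' then exists c u, span s' u /\ x = phi c *: w + u
  else x = 0.

Lemma span_linear s a x y : span s x -> span s y -> span s (phi a *: x + y).
Proof.
elim: s x y => [|w s IHs] x y /=; first by move=> -> ->; rewrite scaler0 addr0.
move=> [c [u [su ->]]] [d [v [sv ->]]].
exists (a * c + d), (phi a *: u + v); split; first exact: IHs.
by rewrite scalerDr scalerA addrACA -scalerDl -rmorphM -rmorphD.
Qed.

Lemma span0 s : span s 0.
Proof.
by elim: s => //= w s IHs; exists 0, 0; rewrite rmorph0 scale0r addr0.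
Qed.

Lemma mem_span s x : x \in s -> span s x.
Proof.
elim: s => //= w s IHs; rewrite inE => /predU1P[->|/IHs xs].
  by exists 1, 0; rewrite rmorph1 scale1r addr0; split=> //; apply: span0.
by exists 0, x; rewrite rmorph0 scale0r add0r.
Qed.

(** Induction on [s]. The coefficients at the head [w] of elements of [I m] in the span form a
    descending chain of left ideals of [k], which stabilises. Two elements with the same coefficient
    at [w] differ by an element of the span of the tail, where the induction hypothesis applies. *)
Lemma chain_span_stable (s : seq M) (I : nat -> submodClosed M) :
  artinian k -> (forall m, {subset I m.+1 <= I m}) ->
  exists m, forall p x, (m <= p)%N -> span s x -> x \in I m -> x \in I p.
Proof.
move=> artk decI.
have subI m p : (m <= p)%N -> {subset I p <= I m}.
  by move=> /subnK <-; elim: (p - m)%N => // q IHq x /decI/IHq.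
elim: s => [|w s [m1 stab1]] /=.
  by exists 0%N => p x _ -> _; apply: rpred0.
have clJ m : submod_closed (fun c : k^o =>
    `[< exists2 u, span s u & phi c *: w + u \in I m >]).
  split=> [|a c d /asboolP[u su cuI] /asboolP[v sv dvI]].
    apply/asboolP; exists 0; first exact: span0.
    by rewrite rmorph0 scale0r addr0 rpred0.
  apply/asboolP; exists (phi a *: u + v); first exact: span_linear.
  rewrite rmorphD rmorphM scalerDl -scalerA addrACA -scalerDr.
  by rewrite rpredD ?rpredZ.
have [m|m2 stab2] := artk (fun m => mk_submod (clJ m)).
  move=> c /asboolP[u su cuI]; apply/asboolP; exists u => //.
  exact: decI cuI.
exists (maxn m1 m2) => p _ le_p [c [u [su ->]]] cuI.
move: le_p; rewrite geq_max => /andP[m1p m2p].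
have /asboolP[v sv cvI] : c \in mk_submod (clJ p).
  rewrite (stab2 _ m2p); apply/asboolP; exists u => //.
  exact: subI (leq_maxr _ _) _ cuI.
have uvI : u - v \in I p.
  apply: stab1 => //.
    by rewrite addrC -scaleN1r -(rmorphN1 phi); apply: span_linear.
  rewrite -(addrKA (phi c *: w)) [u + _]addrC; apply: submodB.
    exact: subI (leq_maxl _ _) _ cuI.
  exact: subI m1p _ cvI.
by rewrite -(subrK v u) [u - v + v]addrC addrA rpredD.
Qed.

Lemma dcc_span (s : seq M) : artinian k -> (forall x, span s x) -> dcc M.
Proof.
move=> artk spanM; apply: dcc_of_chains => I decI.
have [m stab] := chain_span_stable s artk decI.
by exists m => p mp x; apply: stab.
Qed.

End DescendingChains.

(** The products of generators of [A] over [k] with generators of [M] over [A] span [M] over [k]. *)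
Lemma artin_algebra_dcc (k : comNzRingType) (A : algType k) (M : lmodType A) :
  artin_algebra A -> fin_gen M -> dcc M.
Proof.
move=> [artk [p [e genA]]] [m [v genM]].
pose s := [seq e ij.2 *: v ij.1 | ij : 'I_m * 'I_p].
apply: (@dcc_span k A (in_alg A) M s artk) => x.
have sumP (I : finType) (F : I -> M) :
    (forall i, span (in_alg A) s (F i)) -> span (in_alg A) s (\sum_i F i).
  move=> sF; elim/big_ind: _ => [|y z sy sz|i _]; [exact: span0| |exact: sF].
  by rewrite -[y]scale1r -(rmorph1 (in_alg A)); apply: span_linear.
have [a ->] := genM x; apply: (sumP) => i.
have [c ->] := genA (a i); rewrite scaler_suml; apply: (sumP) => j.
rewrite -[c j *: e j]mulr_algl -scalerA -[_ *: _]addr0; apply: span_linear.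
  by apply/mem_span/imageP; exists (i, j).
exact: span0.
Qed.

(** * Linear maps against the radical and socle series *)

Section LinearMaps.
Variable R : pzRingType.
Implicit Types U V W : lmodType R.

Lemma in_preim_submod U V (f : {linear U -> V}) (N : submodClosed V) x :
  (x \in preim_submod f N) = (f x \in N).
Proof. by []. Qed.

Lemma quo_map_eq0 V (N : submodClosed V) x : (quo_map N x == 0) = (x \in N).
Proof. by rewrite -(linear0 (quo_map N)) quo_eqP subr0. Qed.

Lemma quo_map_surj V (N : submodClosed V) z : exists x, quo_map N x = z.
Proof. by exists (repr z); apply: reprK. Qed.

Lemma quo_lift U V (N : submodClosed U) (f : {linear U -> V}) :
  (forall x, x \in N -> f x = 0) ->
  exists g : {linear quo N -> V}, forall x, g (quo_map N x) = f x.
Proof.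
move=> fN0; pose g (q : quo N) := f (repr q).
have gE x : g (quo_map N x) = f x.
  apply/eqP; rewrite -subr_eq0 -linearB fN0 //.
  by rewrite -quo_eqP reprK.
have g_lin : linear g.
  move=> a p q; have [x <-] := quo_map_surj p; have [y <-] := quo_map_surj q.
  by rewrite -linearP !gE linearP.
pose g' : {linear quo N -> V} := HB.pack g (GRing.isLinear.Build R _ _ _ g g_lin).
by exists g'.
Qed.

Lemma corestrict U V (N : submodClosed V) (f : {linear U -> V}) :
  (forall x, f x \in N) ->
  exists g : {linear U -> submod N}, forall x, val (g x) = f x.
Proof.
move=> fN; pose g x : submod N := Submod (fN x).
have g_lin : linear g by move=> a x y; apply: val_inj; rewrite /= !linearP.
pose g' : {linear U -> submod N} :=
  HB.pack g (GRing.isLinear.Build R _ _ _ g g_lin).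
by exists g'.
Qed.

Lemma image_submod_closed U V (f : {linear U -> V}) (N : submodClosed U) :
  submod_closed (fun y => `[< exists2 x, x \in N & y = f x >]).
Proof.
split; first by apply/asboolP; exists 0; rewrite ?linear0 ?rpred0.
move=> a _ _ /asboolP[x xN ->] /asboolP[y yN ->]; apply/asboolP.
by exists (a *: x + y); rewrite ?linearP// rpredD ?rpredZ.
Qed.

Definition image_submod U V (f : {linear U -> V}) N :=
  mk_submod (image_submod_closed f N).

Lemma image_submodP U V (f : {linear U -> V}) (N : submodClosed U) y :
  reflect (exists2 x, x \in N & y = f x) (y \in image_submod f N).
Proof. exact: asboolP. Qed.

(** For [K'] maximal in [N'], the preimage of [K'] in [N] is [N] itself or maximal in [N]: if [L]
    lies between it and [N], then [f(L) + K'] is [K'] or [N'], and [L] is accordingly the preimage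
    or [N]. *)
Lemma rad_image U V (f : {linear U -> V}) (N : submodClosed U)
    (N' : submodClosed V) :
  (forall x, x \in N -> f x \in N') ->
  forall x, x \in rad_submod N -> f x \in rad_submod N'.
Proof.
move=> fN x /radP[xN xrad]; apply/radP; split=> [|K' [K'N' _ maxK']].
  exact: fN.
pose K := cap_submod N (preim_submod f K').
have [NK|NK] := pselect {subset N <= K}.
  by have := NK x xN; rewrite in_cap_submod => /andP[].
suff: x \in K by rewrite in_cap_submod => /andP[].
apply: xrad; split=> [y|eqK|L KL LN].
- by rewrite in_cap_submod => /andP[].
- by apply: NK => y; rewrite eqK.
have [||eqK'|eqN'] := maxK' (add_submod (image_submod f L) K').
- by move=> y; apply: mem_add_submodr.
- by apply: add_submod_sub => // _ /image_submodP[y /LN/fN yN' ->].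
- left=> y; apply/idP/idP => [yL|/KL//].
  rewrite in_cap_submod LN//= in_preim_submod -eqK'.
  by apply/mem_add_submodl/image_submodP; exists y.
right=> y; apply/idP/idP => [/LN//|yN].
have := fN y yN; rewrite -eqN' => /add_submodP[_ [v [/image_submodP[u uL ->]]]].
move=> vK' def_fy; rewrite -(subrK u y) rpredD//; apply: KL.
rewrite in_cap_submod submodB ?(LN u)//= in_preim_submod linearB def_fy.
by rewrite addrC addKr.
Qed.

Lemma iter_rad_image U V (f : {linear U -> V}) (N : submodClosed U)
    (N' : submodClosed V) i :
  (forall x, x \in N -> f x \in N') ->
  forall x, x \in iter i (@rad_submod R U) N ->
    f x \in iter i (@rad_submod R V) N'.
Proof. by move=> fN; elim: i => //= i IHi; apply: rad_image. Qed.

Lemma radn_image U V (f : {linear U -> V}) i x :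
  x \in radn U i -> f x \in radn V i.
Proof. exact: iter_rad_image. Qed.

Lemma socnS V i : {subset socn V i <= socn V i.+1}.
Proof.
move=> x; rewrite -quo_map_eq0 => /eqP x0.
by change (quo_map (socn V i) x \in soc (quo (socn V i))); rewrite x0 rpred0.
Qed.

Lemma socn_sub V i j : (i <= j)%N -> {subset socn V i <= socn V j}.
Proof.
move=> /subnK <-; elim: (j - i)%N => // m IHm x xi.
by rewrite addSn; apply/socnS/IHm.
Qed.

(** Modulo [Soc_j V] the image of [N] lies in a socle, whose radical is zero by [rad_soc]; so [f]
    maps [rad N] into [Soc_j V], and induction applies to [rad N]. *)
Lemma iter_rad_into_socn U V (f : {linear U -> V}) (N : submodClosed U) j :
  (forall x, x \in N -> f x \in socn V j) ->
  forall x, x \in iter j (@rad_submod R U) N -> f x = 0.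
Proof.
elim: j N => [|j IHj] N fN x; first by move=> /fN; rewrite in_zero_submod => /eqP.
rewrite iterSr; apply: IHj => {}x xN; rewrite -quo_map_eq0; apply/eqP/rad_soc.
exact: (@rad_image _ _ (quo_map (socn V j) \o f) N).
Qed.

Lemma radn_into_socn U V (f : {linear U -> V}) j :
  (forall x, f x \in socn V j) -> forall x, x \in radn U j -> f x = 0.
Proof. by move=> fU; apply: iter_rad_into_socn. Qed.

(* A minimal N' <= N not mapped into the socle contains a minimal T not inside
   rad N; the image of T is simple, and N' = T + (N' :&: K) for a maximal
   submodule K of N not containing T. *)
Lemma dcc_rad_soc U V (f : {linear U -> V}) (N : submodClosed U) :
  dcc U -> (forall x, x \in rad_submod N -> f x = 0) ->
  forall x, x \in N -> f x \in soc V.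
Proof.
move=> dccU frad; apply: contrapT => fN.
pose F (L : submodClosed U) :=
  {subset L <= N} /\ ~ forall x, x \in L -> f x \in soc V.
have [|N' [N'N fN'] minN'] := dccU F; first by exists N; split.
have N'rad : ~ {subset N' <= rad_submod N}.
  by move=> N'rad; apply: fN' => x /N'rad/frad ->; apply: rpred0.
pose F' (L : submodClosed U) :=
  {subset L <= N'} /\ ~ {subset L <= rad_submod N}.
have [|T [TN' Trad] minT] := dccU F'; first by exists N'; split.
have [K maxK TK] : exists2 K, maximal_submod N K & ~ {subset T <= K}.
  apply: contrapT => noK; apply: Trad => x xT; apply/radP.
  split=> [|K maxK]; first by apply/N'N/TN'.
  by apply: contrapT => xK; apply: noK; exists K => // /(_ x xT).
have fT x : x \in T -> f x \in soc V.
  move=> xT; have [fx0|fx0] := eqVneq (f x) 0; first by rewrite fx0 rpred0.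
  have simT : simple_submod (image_submod f T).
    split=> [eq0|L LT].
      move: fx0; rewrite -in_zero_submod -eq0 => /negP; apply.
      by apply/image_submodP; exists x.
    pose L' := cap_submod T (preim_submod f L).
    have L'T : {subset L' <= T} by move=> y; rewrite in_cap_submod => /andP[].
    have [L'rad|L'rad] := pselect {subset L' <= rad_submod N}.
      left=> y; rewrite in_zero_submod; apply/idP/eqP => [yL|->]; last first.
        exact: rpred0.
      have /image_submodP[z zT def_y] := LT y yL.
      rewrite def_y; apply/frad/L'rad.
      by rewrite in_cap_submod zT in_preim_submod -def_y.
    have TL' : {subset T <= L'} by apply: minT => //; split=> // y /L'T/TN'.
    right=> y; apply/idP/idP => [/LT//|/image_submodP[z /TL' zL' ->]].
    by move: zL'; rewrite in_cap_submod => /andP[].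
  by apply: (simple_sub_soc simT); apply/image_submodP; exists x.
have KN' : {subset cap_submod N' K <= N'}.
  by move=> y; rewrite in_cap_submod => /andP[].
(* Otherwise minimality of [N'] would put [N'], and with it [T], inside [K]. *)
have fK x : x \in cap_submod N' K -> f x \in soc V.
  move: x; apply: contrapT => fK; apply: TK => x /TN' xN'.
  suff /(_ x xN'): {subset N' <= cap_submod N' K}.
    by rewrite in_cap_submod => /andP[].
  by apply: minN' => //; split=> // y /KN'/N'N.
apply: fN' => x xN'.
have TN : {subset T <= N} by move=> y /TN'/N'N.
have /add_submodP[u [v [uT vK def_x]]] := maximal_add maxK TN TK (N'N x xN').
rewrite def_x linearD; apply: rpredD; first exact: fT.
apply: fK; rewrite in_cap_submod vK andbT.
by rewrite -(addKr u v) -def_x addrC; exact: submodB xN' (TN' u uT).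
Qed.

(** Converse of [iter_rad_into_socn]. By induction [f] maps [rad N] into [Soc_j V], so the composite
    to [V / Soc_j V] kills [rad N] and [dcc_rad_soc] applies to it. *)
Lemma dcc_iter_rad_socn U V (f : {linear U -> V}) (N : submodClosed U) j :
  dcc U -> (forall x, x \in iter j (@rad_submod R U) N -> f x = 0) ->
  forall x, x \in N -> f x \in socn V j.
Proof.
move=> dccU; elim: j N => [|j IHj] N fN x xN.
  by rewrite in_zero_submod fN.
apply: (@dcc_rad_soc _ _ (quo_map (socn V j) \o f) N) => // y yN.
apply/eqP; rewrite quo_map_eq0; apply: (IHj (rad_submod N)) => // z.
by rewrite -iterSr; apply: fN.
Qed.

Lemma dcc_radn_socn U V (f : {linear U -> V}) j :
  dcc U -> (forall x, x \in radn U j -> f x = 0) -> forall x, f x \in socn V j.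
Proof. by move=> dccU fU x; apply: (@dcc_iter_rad_socn _ _ _ full_submod). Qed.

End LinearMaps.

(** * Projective indecomposables: locality, radical series and split surjections *)

Section ProjectiveIndecomposable.
Variables (R : pzRingType) (P : lmodType R).
Hypotheses (dccP : dcc P) (projP : projective P) (indecP : indecomposable P).
Implicit Types N K L T : submodClosed P.

(* Standard supplement argument: T is minimal with T + K = P and L <= K minimal
   with T + L = P.  Projectivity gives f : P -> T with f = id modulo L; then
   ker f = ker f^2 = L by minimality, so T and L are complements. *)
Lemma proj_indec_hollow K N :
  (forall x, x \in add_submod N K) ->
  (forall x, x \in K) \/ (forall x, x \in N).
Proof.
move=> NK.
pose F T := {subset T <= N} /\ forall x, x \in add_submod T K.
have [|T [TN TK] minT] := dccP (F := F); first by exists N; split.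
pose F' L := {subset L <= K} /\ forall x, x \in add_submod T L.
have [|L [LK TL] minL] := dccP (F := F'); first by exists K; split.
(* As [f] is the identity modulo [L], which lies in [K], also [f(T) + K = P], and minimality of [T]
   applies to [f(T)]. *)
have fTT (f : {linear P -> P}) : (forall x, f x \in T) ->
    (forall x, f x - x \in L) -> {subset T <= image_submod f T}.
  move=> fT fL; apply: minT; last by move=> _ /image_submodP[y _ ->].
  split=> [_ /image_submodP[y _ ->]|y]; first exact: TN.
  have /add_submodP[u [v [uT vK ->]]] := TK y.
  apply/add_submodP; exists (f u), (- (f u - u) + v); split.
  - by apply/image_submodP; exists u.
  - by rewrite rpredD// submodN// LK.
  by rewrite opprB addrA subrKC.
have projL (f : {linear P -> P}) : (forall x, f x \in T) ->
    (forall x, f x - x \in L) -> forall x, (f x == 0) = (x \in L).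
  move=> fT fL x.
  pose ker := preim_submod f zero_submod.
  have kerL : {subset ker <= L}.
    move=> y; rewrite in_preim_submod in_zero_submod => /eqP fy0.
    by have := submodN (fL y); rewrite fy0 sub0r opprK.
  rewrite -in_zero_submod -in_preim_submod; apply/idP/idP => [/kerL//|].
  move: x; apply: minL => //; split=> [y /kerL/LK//|y].
  have /image_submodP[t tT def_fy] := fTT f fT fL _ (fT y).
  apply/add_submodP; exists t, (y - t); split; rewrite // ?subrKC//.
  by rewrite in_preim_submod in_zero_submod linearB def_fy subrr.
have [y|h hP] := @projP _ _ (quo_map L \o incl T) (quo_map L).
  have [x <-] := quo_map_surj y.
  have /add_submodP[u [v [uT vL ->]]] := TL x; exists (Submod uT) => /=.
  by apply/eqP; rewrite -subr_eq0 -linearB quo_map_eq0 opprD addNKr submodN.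
pose f : {linear P -> P} := incl T \o h.
have fT x : f x \in T by rewrite /f /=; case: (h x).
have fL x : f x - x \in L by rewrite -quo_map_eq0 linearB subr_eq0; apply/eqP/hP.
have ff x : (f (f x) == 0) = (x \in L).
  apply: (projL (f \o f)) => y /=; first exact: fT.
  by have := rpredD (fL (f y)) (fL y); rewrite addrA subrK.
case: indecP => [[x0 x0n0]] /(_ T L)[x xT xL|x|T0|L0].
(* With [x = f t], the equation [f x = 0] reads [f (f t) = 0]; hence [t] is in [L] and [f t = 0]. *)
- have /image_submodP[t tT def_x] := fTT f fT fL x xT.
  have : f x == 0 by rewrite (projL f).
  by rewrite def_x ff -(projL f)// => /eqP.
- have /add_submodP[u [v [uT vL ->]]] := TL x; exists u, v; split=> //.
- left=> x; have /add_submodP[u [v [uT vL ->]]] := TL x.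
  move: uT; rewrite T0 in_zero_submod => /eqP->; rewrite add0r; exact: LK.
right=> x; have /add_submodP[u [v [uT vL ->]]] := TL x.
move: vL; rewrite L0 in_zero_submod => /eqP->; rewrite addr0; exact: TN.
Qed.

End ProjectiveIndecomposable.

(** Once two consecutive terms agree the radical series is constant, so [Rad^i P] would already be
    zero, against the minimality of [m]. *)
Lemma loewy_rad_strict (R : pzRingType) (P : lmodType R) m i :
  is_loewy_length P m -> (i < m)%N -> ~ {subset radn P i <= radn P i.+1}.
Proof.
move=> [radm0 minm] im stat.
have statq q : {subset radn P i <= radn P (q + i)}.
  elim: q => // q IHq x /stat; apply: (iter_rad_image (f := idfun) (i := 1)).
  exact: IHq.
move: im; rewrite ltnNge => /negP; apply; apply: minm => x.
apply/idP/idP => [xi|]; last by rewrite in_zero_submod => /eqP->; apply: rpred0.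
have [le_im|lt_mi] := leqP i m; rewrite -radm0.
  by rewrite -(subnK le_im); apply: statq.
exact: radn_sub (ltnW lt_mi) _ xi.
Qed.

Section LocalProjectives.
Variables (R : pzRingType) (P : lmodType R) (m : nat).
Hypotheses (dccP : dcc P) (projP : projective P) (indecP : indecomposable P).
Hypothesis loewyP : is_loewy_length P m.

Lemma indec_loewy_gt0 : (0 < m)%N.
Proof.
rewrite lt0n; apply/eqP => m0; case: indecP => -[x x0] _; case/negP: x0.
by rewrite -in_zero_submod -(loewyP.1) m0.
Qed.

Lemma not_in_rad_top : exists y, y \notin radn P 1.
Proof.
apply: contrapT => noy; apply: (loewy_rad_strict loewyP indec_loewy_gt0) => x _.
by apply/negPn/negP => xr; apply: noy; exists x.
Qed.

(** Some maximal submodule [K] does not contain the image of [g], so the image and [K] together span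
    [P]; as [K] is proper, [proj_indec_hollow] makes the image everything. *)
Lemma proj_indec_surj (U : lmodType R) (g : {linear U -> P}) :
  ~ (forall z, g z \in radn P 1) -> forall y, exists z, g z = y.
Proof.
move=> grad y.
have [K maxK gK] : exists2 K, maximal_submod (radn P 0) K &
    ~ {subset im_submod g <= K}.
  apply: contrapT => noK; apply: grad => z; apply/radP; split=> // K maxK.
  apply: contrapT => zK; apply: noK; exists K => // /(_ (g z)) zK'.
  by apply/zK/zK'/asboolP; exists z.
have [|Kfull|gfull] := @proj_indec_hollow R P dccP projP indecP K (im_submod g).
- by move=> x; apply: (maximal_add maxK).
- by case: gK => x _.
by have /asboolP[z ->] := gfull y; exists z.
Qed.

Lemma proj_section (U : lmodType R) (g : {linear U -> P}) :
  (forall y, exists z, g z = y) ->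
  exists s : {linear P -> U}, forall y, g (s y) = y.
Proof. by move=> gsurj; apply: (@projP _ _ g idfun). Qed.

(** A section [s] of [g] splits [U] into the kernel of [g] and the image of [s]; the image is
    nonzero because [P] is, so the kernel vanishes. *)
Lemma surj_indec_iso (U : lmodType R) (g : {linear U -> P}) :
  indecomposable U -> (forall y, exists z, g z = y) -> iso U P.
Proof.
move=> [_ indecU] gsurj; have [s gs] := proj_section gsurj.
have [x|x|ker0|im0] := indecU (preim_submod g zero_submod) (im_submod s).
- rewrite in_preim_submod in_zero_submod => /eqP gx0 /asboolP[y def_x].
  by move: gx0; rewrite def_x gs => ->; rewrite linear0.
- exists (x - s (g x)), (s (g x)); split; last by rewrite subrK.
    by rewrite in_preim_submod in_zero_submod linearB gs subrr.
  by apply/asboolP; exists (g x).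
- exists g, s => // x; apply/eqP; rewrite eq_sym -subr_eq0 -in_zero_submod -ker0.
  by rewrite in_preim_submod in_zero_submod linearB gs subrr.
case: indecP => -[x x0] _; case/negP: x0; rewrite -(gs x).
have : s x \in im_submod s by apply/asboolP; exists x.
by rewrite im0 in_zero_submod => /eqP->; rewrite linear0.
Qed.

End LocalProjectives.

(** * Finite direct sums, their traces, and comparison of quotients *)

Section DirectSumMaps.
Variables (R : pzRingType) (I : finType) (X : I -> lmodType R).

Definition dsum_proj i (u : dsum X) : X i := u i.

Lemma dsum_proj_linear i : linear (dsum_proj i).
Proof. by []. Qed.

HB.instance Definition _ i := GRing.isLinear.Build R (dsum X) (X i) *:%R
  (dsum_proj i) (dsum_proj_linear i).

Definition dsum_inj i (v : X i) : dsum X := dfwith (0 : dsum X) v.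

Lemma dsum_inj_id i (v : X i) : dsum_inj v i = v.
Proof. exact: dfwith_in. Qed.

Lemma dsum_inj_neq i j (v : X i) : i != j -> dsum_inj v j = 0.
Proof. exact: dfwith_out. Qed.

Lemma dsum_inj_linear i : linear (@dsum_inj i).
Proof.
move=> a u v; apply: dsumP => j; change (dsum_inj (a *: u + v) j =
  a *: (dsum_inj u j) + dsum_inj v j).
have [<-|ij] := eqVneq i j; first by rewrite !dsum_inj_id.
by rewrite !dsum_inj_neq// scaler0 addr0.
Qed.

HB.instance Definition _ i := GRing.isLinear.Build R (X i) (dsum X) *:%R
  (@dsum_inj i) (@dsum_inj_linear i).

Lemma dsum_sumE (J : Type) (s : seq J) (F : J -> dsum X) i :
  (\sum_(j <- s) F j) i = \sum_(j <- s) F j i.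
Proof. exact: (linear_sum (dsum_proj i)). Qed.

Lemma dsum_sum_inj (u : dsum X) : u = \sum_i dsum_inj (u i).
Proof.
apply: dsumP => i; rewrite dsum_sumE (bigD1 i)//= dsum_inj_id.
by rewrite big1 ?addr0// => j ji; rewrite dsum_inj_neq.
Qed.

Lemma dsum_sum_inj_id (F : forall i, X i) j : (\sum_i dsum_inj (F i)) j = F j.
Proof. by rewrite -(dsum_sum_inj F). Qed.

Lemma trace_dsum_sub (V : lmodType R) (N : submodClosed V) :
  (forall i (f : {linear X i -> V}) y, f y \in N) ->
  {subset trace (dsum X) V <= N}.
Proof.
move=> XN; apply: sum_submod_sub => _ [f ->] _ /asboolP[u ->].
rewrite (dsum_sum_inj u) linear_sum rpred_sum// => i _.
exact: (XN i (f \o @dsum_inj i)).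
Qed.

Lemma mem_trace_dsum (V : lmodType R) i (f : {linear X i -> V}) y :
  f y \in trace (dsum X) V.
Proof.
apply: (mem_sum_submod (K := im_submod (f \o dsum_proj i))).
  by exists (f \o dsum_proj i).
by apply/asboolP; exists (dsum_inj y); rewrite /= /dsum_proj dsum_inj_id.
Qed.

Variables (V : lmodType R) (f : forall i, {linear X i -> V}).

Lemma dsum_desc : exists g : {linear dsum X -> V}, forall u, g u = \sum_i f i (u i).
Proof.
pose g (u : dsum X) := \sum_i f i (u i).
have g_lin : linear g.
  move=> a u v; rewrite /g scaler_sumr -big_split; apply: eq_bigr => i _.
  exact: linearP.
pose g' : {linear dsum X -> V} := HB.pack g (GRing.isLinear.Build R _ _ _ g g_lin).
by exists g'.
Qed.

End DirectSumMaps.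

Lemma dsum_map (R : pzRingType) (I : finType) (X Y : I -> lmodType R)
    (f : forall i, {linear X i -> Y i}) :
  exists g : {linear dsum X -> dsum Y}, forall u i, g u i = f i (u i).
Proof.
pose g (u : dsum X) : dsum Y := fun i => f i (u i).
have g_lin : linear g by move=> a u v; apply: dsumP => i; apply: linearP.
pose g' : {linear dsum X -> dsum Y} :=
  HB.pack g (GRing.isLinear.Build R _ _ _ g g_lin).
by exists g'.
Qed.

(** The isomorphism is [b] after a set-theoretic section of [a], linear because the kernels
    agree. *)
Lemma iso_same_kernel (R : pzRingType) (E B C : lmodType R)
    (a : {linear E -> B}) (b : {linear E -> C}) :
  (forall y, exists x, a x = y) -> (forall y, exists x, b x = y) ->
  (forall x, a x = 0 <-> b x = 0) -> iso B C.
Proof.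
move=> /choice[a' a'K] /choice[b' b'K] kerE.
have eqE x y : a x = a y <-> b x = b y.
  split=> /eqP; rewrite -subr_eq0 -linearB => /eqP/kerE/eqP;
  by rewrite linearB subr_eq0 => /eqP.
pose f y := b (a' y).
have f_lin : linear f.
  by move=> c y z; rewrite /f -linearP; apply/eqE; rewrite linearP !a'K.
pose f' : {linear B -> C} := HB.pack f (GRing.isLinear.Build R _ _ _ f f_lin).
exists f', (a \o b') => y; rewrite /f' /f /=.
  by rewrite -[RHS]a'K; apply/eqE; rewrite b'K.
by rewrite -[RHS]b'K; apply/eqE; rewrite a'K.
Qed.

Lemma LHom_sumE (R : pzRingType) (U V : lmodType R) (I : Type) (s : seq I)
    (F : I -> LHom U V) u :
  (\sum_(i <- s) F i) u = \sum_(i <- s) F i u.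
Proof. by elim/big_rec2: _ => // i y f _ <-. Qed.

Lemma LHom_submodP (R : pzRingType) (U V : lmodType R) (N : submodClosed V)
    (f : LHom U V) :
  f \in LHom_submod U N <-> forall u, f u \in N.
Proof.
split=> [/asboolP[g -> u]|fN]; first exact: (valP (g u)).
have [g gE] := corestrict fN; apply/asboolP; exists g.
by apply: LHomP => u; rewrite -gE.
Qed.

(** Trades an isomorphism from [N / K] for a surjection from [N] with kernel [K], along which maps
    from projectives can be lifted. *)
Lemma subquo_iso (R : pzRingType) (V Y : lmodType R) (N K : submodClosed V) :
  iso (subquo N K) Y ->
  exists psi : {linear submod N -> Y}, (forall y, exists u, psi u = y) /\
    forall u, psi u = 0 <-> val u \in K.
Proof.
move=> [f bijf]; exists (f \o quo_map (preim_submod (incl N) K)); split=> [y|u].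
  have [g gK fK] := bijf; have [u uE] := quo_map_surj (g y).
  by exists u; rewrite /= uE fK.
rewrite -[val u \in K]/(u \in preim_submod (incl N) K) -quo_map_eq0 /=.
by split=> [fu0|/eqP->]; [apply/eqP/(bij_inj bijf)|]; rewrite linear0.
Qed.

(** * Yoneda for the modules [PR P q], and traces in terms of [A]-linear maps *)

Section ADRModules.
Variables (A : pzRingType) (n : nat) (P : 'I_n -> lmodType A) (l : 'I_n -> nat).
Local Notation G := (Gmod P l).
Implicit Types (p q : Lam l) (V : lmodType A).

Local Notation lam i := (Tagged (fun k => 'I_(l k)) i : Lam l).
Local Notation pr q := (quo_map (radn (P (tag q)) (level q))).

Lemma HomG_decomp V (f : HomG P l V) :
  f = \sum_q LHom_map (f \o @dsum_inj _ _ _ q)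
                      (@dsum_proj _ _ (quo_rad P (l := l)) q : PR P q).
Proof.
apply: LHomP => u; rewrite LHom_sumE {1}(dsum_sum_inj u) linear_sum.
by apply: eq_bigr.
Qed.

(** Yoneda: the projection [pi] of [G] onto its summand [q] generates [PR P q], since [f] is the
    multiple of [pi] by [iq \o f]. Hence [phi] is determined by [phi pi]. *)
Lemma PR_hom q V (phi : {linear PR P q -> HomG P l V}) :
  exists g : {linear quo_rad P q -> V}, forall f, phi f = LHom_map g f.
Proof.
pose pi : PR P q := @dsum_proj _ _ (quo_rad P (l := l)) q.
pose iq : {linear quo_rad P q -> G} := @dsum_inj _ _ _ q.
exists ((phi pi : LHom G V) \o iq) => f.
have -> : f = ((iq \o f : Endo G) : ADR P l) *: pi.
  by apply: LHomP => u; rewrite /= /dsum_proj dsum_inj_id.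
rewrite linearZ; apply: LHomP => u /=.
by rewrite /dsum_proj dsum_inj_id.
Qed.

Lemma trace_PR_sub (C : pred (Lam l)) V (W : submodClosed V) :
  (forall q (g : {linear quo_rad P q -> V}), C q -> forall z, g z \in W) ->
  {subset trace (dsum (fun q : {q | C q} => PR P (val q))) (HomG P l V)
     <= LHom_submod G W}.
Proof.
move=> CW; apply: trace_dsum_sub => -[q Cq] /= phi f.
have [g ->] := PR_hom phi; apply/LHom_submodP => u; exact: CW.
Qed.

(** A map out of [G] is the sum of its restrictions to the summands, and a restriction that factors
    through a summand with index in [C] is in the trace. The alternative [g = 0] serves the case
    where no such summand is available. *)
Lemma sub_trace_PR (C : pred (Lam l)) V (W : submodClosed V) :
  (forall q (g : {linear quo_rad P q -> V}), (forall z, g z \in W) ->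
     exists (q' : Lam l) (t : {linear quo_rad P q -> quo_rad P q'})
         (g' : {linear quo_rad P q' -> V}),
       (C q' \/ forall z, g z = 0) /\ forall z, g z = g' (t z)) ->
  {subset LHom_submod G W
     <= trace (dsum (fun q : {q | C q} => PR P (val q))) (HomG P l V)}.
Proof.
move=> WC f /LHom_submodP fW; rewrite [f]HomG_decomp; apply: rpred_sum => q _.
have [|q' [t [g' [[Cq'|f0] fE]]]] := WC q (f \o @dsum_inj _ _ _ q).
- by move=> z; apply: fW.
- have -> : LHom_map (f \o @dsum_inj _ _ _ q)
     (@dsum_proj _ _ (quo_rad P (l := l)) q : PR P q) =
     LHom_map g' (t \o @dsum_proj _ _ (quo_rad P (l := l)) q : PR P q').
    by apply: LHomP => u; apply: fE.
  exact: (@mem_trace_dsum _ _ (fun q : {q | C q} => PR P (val q)) _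
    (exist (fun q => C q) q' Cq') (LHom_map (U := G) g')).
set h := LHom_map _ _; suff -> : h = 0 by apply: rpred0.
by apply: LHomP => u; apply: f0.
Qed.

Lemma quo_rad_factor k (i i' : 'I_(l k)) V
    (g : {linear quo_rad P (lam i) -> V}) :
  (i' <= i)%N -> (forall y, y \in radn (P k) i'.+1 -> g (quo_map _ y) = 0) ->
  exists (t : {linear quo_rad P (lam i) ->
                      quo_rad P (lam i')})
         (g' : {linear quo_rad P (lam i') -> V}),
    forall z, g z = g' (t z).
Proof.
move=> le_i gr.
have [|t tE] := @quo_lift _ (P k) _ (radn (P k) i.+1) (quo_map (radn (P k) i'.+1)).
  by move=> x xi; apply/eqP; rewrite quo_map_eq0; apply: radn_sub xi.
have [|g' g'E] := @quo_lift _ (P k) _ (radn (P k) i'.+1) (g \o quo_map _).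
  exact: gr.
exists t, g' => z; have [y <-] := quo_map_surj z.
by rewrite tE g'E.
Qed.

(** * Maps into the socle series as a trace *)

Hypotheses (dccP : forall i, dcc (P i)) (projP : forall i, projective (P i)).
Hypotheses (indecP : forall i, indecomposable (P i)).
Hypotheses (neqP : forall i j, iso (P i) (P j) -> i = j).
Hypothesis loewyP : forall i, is_loewy_length (P i) (l i).

Lemma quo_rad_socn q V (g : {linear quo_rad P q -> V}) z : g z \in socn V (level q).
Proof.
have [y <-] := quo_map_surj z.
apply: (@dcc_radn_socn _ _ _ (g \o pr q)) => // x xr /=.
by have /eqP -> : pr q x == 0; [rewrite quo_map_eq0|rewrite linear0].
Qed.

Lemma LHom_socn_trace V j : (1 <= j)%N ->
  LHom_submod G (socn V j) =i
  trace (dsum (fun q : {q : Lam l | (level q <= j)%N} => PR P (val q))) (HomG P l V).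
Proof.
move=> j_gt0 f; apply/idP/idP; last first.
  move: f; apply: trace_PR_sub => q g le_qj z.
  exact: socn_sub le_qj _ (quo_rad_socn g z).
move: f; apply: sub_trace_PR => -[k i] g gj.
have [le_ij|lt_ji] := leqP i.+1 j.
  by exists (lam i), idfun, g; split => //; left.
(* From here the socle index is [j.+1], the level of the ordinal [j]; [g] kills [Rad^(j+1)] and so
   factors through that level. *)
case: j => // j in j_gt0 gj lt_ji *.
have lt_j : (j < l k)%N by apply: ltn_trans (ltn_ord i).
have [||t [g' gE]] := @quo_rad_factor k i (Ordinal lt_j) _ g.
- exact: ltnW.
- move=> y yr; apply: (@radn_into_socn _ _ _ (g \o pr (lam i)) j.+1 _ y yr) => x.
  exact: gj.
by exists (lam (Ordinal lt_j)), t, g'; split => //; left.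
Qed.

(** * Radicals of the summands of [G] and the standard modules *)

Definition rad_quo_rad q : submodClosed (quo_rad P q) :=
  image_submod (pr q) (radn (P (tag q)) 1).

Lemma in_rad_quo_rad q y : (pr q y \in rad_quo_rad q) = (y \in radn (P (tag q)) 1).
Proof.
apply/image_submodP/idP => [[x xr /eqP]|yr]; last by exists y.
rewrite quo_eqP => yx; rewrite -(subrK x y) rpredD//.
exact: (@radn_sub _ _ 1 (level q)) yx.
Qed.

Lemma quo_rad_lift q p (g : {linear quo_rad P q -> quo_rad P p}) :
  exists h : {linear P (tag q) -> P (tag p)}, forall y, pr p (h y) = g (pr q y).
Proof. exact: (@projP _ _ _ (pr p) (g \o pr q) (quo_map_surj (N := _))). Qed.

Lemma quo_rad_into_rad q p (g : {linear quo_rad P q -> quo_rad P p}) :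
  ~~ lam_le q p -> forall z, g z \in rad_quo_rad p.
Proof.
rewrite /lam_le negb_or -leqNgt => /andP[neq_qp le_qp].
have [h hE] := quo_rad_lift g.
have [hrad z|hrad] := pselect (forall y, h y \in radn (P (tag p)) 1).
  by have [y <-] := quo_map_surj z; rewrite -hE in_rad_quo_rad.
have hsurj := proj_indec_surj (@dccP _) (@projP _) (@indecP _) hrad.
have eq_tag := neqP (surj_indec_iso (@projP _) (@indecP _) (@indecP _) hsurj).
have [s hs] := proj_section (@projP _) hsurj.
have lt_qp : (level q < level p)%N.
  move: neq_qp le_qp eq_tag {g h hE hrad hsurj s hs}.
  case: q p => [k i] [k' i'] /= + + eq_k.
  case: _ / eq_k i' => i'.
  rewrite /level /= -tag_eqE /tag_eq /= eqxx tagged_asE /= => ne le.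
  by rewrite ltn_neqAle le andbT eqSS.
(* The section [s] carries [Rad^(level q)] of the target into that of the source, which [pr q]
   kills. So [x = h (s x)] lies in [Rad^(level p)], and the radical series would be stationary at
   [level q]. *)
case: (@loewy_rad_strict _ _ _ (level q) (loewyP (tag p))) => [|x xr].
  exact: leq_trans lt_qp (ltn_ord (tagged p)).
rewrite -(hs x); apply: radn_sub lt_qp _ _; rewrite -quo_map_eq0 hE.
have /eqP -> : pr q (s x) == 0 by rewrite quo_map_eq0 radn_image.
by rewrite linear0.
Qed.

(** Identifies the kernel of the projection from [PR P p] to [Delta P p]. A map into the radical
    lifts to an [h] that raises radical powers by one, so from level at least [level p] it factors
    through level [level p - 1], an index allowed in the trace. *)
Lemma trace_PR_rad p :
  trace (dsum (fun q : {q | ~~ lam_le q p} => PR P (val q))) (PR P p) =i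
  LHom_submod G (rad_quo_rad p).
Proof.
move=> f; apply/idP/idP; move: f.
  by apply: trace_PR_sub => q g qp z; apply: quo_rad_into_rad.
apply: (@sub_trace_PR (fun q => ~~ lam_le q p)) => -[k i] g gr.
have [lt_ip|le_pi] := ltnP i.+1 (level p).
  exists (lam i), idfun, g; split=> //; left.
  rewrite /lam_le negb_or -leqNgt (ltnW lt_ip) andbT.
  by apply: contraTneq lt_ip => <-; rewrite ltnn.
have [h hE] := quo_rad_lift g.
have hr y : h y \in radn (P (tag p)) 1 by rewrite -in_rad_quo_rad hE.
have hrad m y : y \in radn (P k) m -> h y \in radn (P (tag p)) m.+1.
  move=> yr; rewrite /radn iterSr.
  by apply: (@iter_rad_image _ _ _ h full_submod) yr => z _; apply: hr.
(* At level 1 the radical of [P / Rad P] is zero, hence so is [g]. *)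
have [p1|p_gt1] := leqP (level p) 1.
  exists (lam i), idfun, g; split=> //; right=> z.
  have [y <-] := quo_map_surj z; rewrite -hE; apply/eqP; rewrite quo_map_eq0.
  exact: radn_sub p1 _ (hr y).
(* Level [level p - 1] equals [tagged p], and its ordinal is one less again. *)
have lt_p : ((tagged p).-1 < l k)%N.
  rewrite -ltnS prednK//; apply: leq_trans le_pi _; exact: leqW.
have [||t [g' gE]] := @quo_rad_factor k i (Ordinal lt_p) _ g.
- by rewrite /= (leq_trans (leq_pred _)) //; rewrite /level ltnS in le_pi.
- have -> : (Ordinal lt_p).+1 = tagged p by rewrite /= prednK.
  move=> y yr; rewrite -hE; apply/eqP; rewrite quo_map_eq0.
  exact: hrad.
exists (lam (Ordinal lt_p)), t, g'; split => //; left.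
rewrite /lam_le negb_or -leqNgt /level /= prednK// leqnSn andbT.
apply/eqP => /(congr1 (@level n l)); rewrite /level /= prednK// => /eqP.
by rewrite ltn_eqF.
Qed.

(** * The socle layer of index [j.+1] and its standard modules *)

Section SocleLayer.
Variables (V : lmodType A) (j : nat) (Theta : finType) (x : Theta -> 'I_n).
Variable psi : {linear submod (socn V j.+1) -> dsum (fun t => top (P (x t)))}.
Hypotheses (psi_surj : forall y, exists u, psi u = y)
  (psi_ker : forall u, psi u = 0 <-> val u \in socn V j).
Local Notation X := (fun t => top (P (x t))).

Lemma socle_layer_lift :
  exists h : forall t, {linear P (x t) -> submod (socn V j.+1)},
    forall t y, psi (h t y) = @dsum_inj _ _ X t (quo_map (radn (P (x t)) 1) y).
Proof.
apply: (@fin_all_exists _ _ (fun t (h : {linear P (x t) -> submod (socn V j.+1)}) =>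
  forall y, psi (h y) = @dsum_inj _ _ X t (quo_map (radn (P (x t)) 1) y))) => t.
exact: (@projP _ _ _ psi (@dsum_inj _ _ X t \o quo_map (radn (P (x t)) 1)) psi_surj).
Qed.

(** Ensures that the pair of [x t] and level [j.+1] is in [Lam l]. If the Loewy length were at most
    [j], the lift of [P (x t)] would land in [Soc_j V], the kernel of [psi], although its image
    under [psi] is a nonzero top. *)
Lemma socle_layer_level t : (j < l (x t))%N.
Proof.
have [h hE] := socle_layer_lift; rewrite ltnNge; apply/negP => le_lj.
have [y /negP] := not_in_rad_top (@indecP (x t)) (loewyP (x t)); apply.
have hsoc : val (h t y) \in socn V (l (x t)).
  apply: (@dcc_radn_socn _ _ _ (incl _ \o h t)) => // z.
  by rewrite (loewyP (x t)).1 in_zero_submod => /eqP->; rewrite linear0.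
have /psi_ker : val (h t y) \in socn V j by apply: socn_sub hsoc.
rewrite hE => /(congr1 (fun u : dsum X => u t)); rewrite dsum_inj_id => y0.
by rewrite -quo_map_eq0; apply/eqP.
Qed.

Definition layer_index t : Lam l := lam (Ordinal (socle_layer_level t)).
Local Notation p := layer_index.

Lemma top_map t : exists r : {linear quo_rad P (p t) -> top (P (x t))},
  (forall y, r (pr (p t) y) = quo_map _ y) /\
  forall z, r z = 0 <-> z \in rad_quo_rad (p t).
Proof.
have [|r rE] := @quo_lift _ (P (x t)) _ (radn _ j.+1) (quo_map (radn (P (x t)) 1)).
  by move=> y yj; apply/eqP; rewrite quo_map_eq0; apply: radn_sub yj.
exists r; split=> // z; have [y <-] := quo_map_surj z.
by rewrite in_rad_quo_rad rE -quo_map_eq0; split=> [->|/eqP].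
Qed.

Lemma layer_index_lift :
  exists h : forall t, {linear quo_rad P (p t) -> submod (socn V j.+1)},
    forall t y, psi (h t (pr (p t) y)) =
                @dsum_inj _ _ X t (quo_map (radn (P (x t)) 1) y).
Proof.
have [h hE] := socle_layer_lift.
suff : forall t, exists h' : {linear quo_rad P (p t) -> submod (socn V j.+1)},
    forall y, h' (pr (p t) y) = h t y.
  move=> /fin_all_exists[h' h'E]; exists h' => t y.
  by rewrite h'E hE.
move=> t; apply: quo_lift => y yj; apply: val_inj; rewrite linear0.
by apply: (@radn_into_socn _ _ _ (incl _ \o h t) j.+1) yj => z; apply: (valP (h t z)).
Qed.

(** Both quotients are compared through [psi]: by [a0u] the components of [psi \o a0 e] are the maps
    [r t \o e t], so each kernel consists of the [e] whose components all land in the radicals. *)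
Lemma LHom_socle_layer :
  iso (subquo (LHom_submod G (socn V j.+1)) (LHom_submod G (socn V j)))
      (dsum (fun t => Delta P (p t))).
Proof.
have [h hE] := layer_index_lift.
have [r rP] := fin_all_exists top_map.
have hr t z : psi (h t z) = @dsum_inj _ _ X t (r t z).
  by have [y <-] := quo_map_surj z; rewrite hE (rP t).1.
pose E := dsum (fun t => PR P (p t)).
have [a0 a0E] := @dsum_desc _ _ (fun t => PR P (p t))
  (HomG P l (submod (socn V j.+1)))
  (fun t => LHom_map (U := G) (h t)).
have a0u (e : E) (u : G) t : psi (a0 e u) t = r t (e t u).
  rewrite a0E LHom_sumE linear_sum -[RHS](dsum_sum_inj_id (fun t => r t (e t u))).
  by rewrite !dsum_sumE; apply: eq_bigr => i _; rewrite -hr.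
have [|a1 a1E] := @corestrict _ _ _ (LHom_submod G (socn V j.+1))
  (LHom_map (U := G) (incl (socn V j.+1)) \o a0).
  by move=> e; apply/LHom_submodP => u; apply: (valP (a0 e u)).
have [b bE] := @dsum_map _ _ (fun t => PR P (p t)) (fun t => Delta P (p t))
  (fun t => quo_map _).
apply: (@iso_same_kernel _ E _ _ (quo_map _ \o a1) b).
- move=> y; have [[f fP] <-] := quo_map_surj y; move/LHom_submodP: (fP) => fsoc.
  have [f' f'E] := corestrict fsoc.
  (* As [psi] has kernel [Soc_j V], it is enough to hit [f'] after [psi], one summand of [G] at a
     time. *)
  suff : forall q, exists e : E, forall u : G,
      psi (a0 e u) = psi (f' (@dsum_inj _ _ (quo_rad P (l := l)) q (u q))).
    move=> /fin_all_exists[e eE]; exists (\sum_q e q); apply/eqP.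
    rewrite quo_eqP in_preim_submod; apply/LHom_submodP => u.
    rewrite linearB /= a1E /= -f'E -[_ - _]/(val (a0 (\sum_q e q) u - f' u)).
    apply/psi_ker/eqP; rewrite linearB subr_eq0 linear_sum LHom_sumE linear_sum.
    rewrite [u in f' u]dsum_sum_inj !linear_sum; apply/eqP.
    by apply: eq_bigr => q _; apply: eE.
  move=> q; pose g := f' \o @dsum_inj _ _ (quo_rad P (l := l)) q.
  have [le_qj|lt_jq] := leqP (level q) j.
    exists 0 => u; rewrite !linear0; apply/esym/psi_ker.
    exact: socn_sub le_qj _ (quo_rad_socn (incl _ \o g) (u q)).
  (* Here [level q] is at least [j.+1]. Lifting along the sum of the projections onto the tops gives
     maps from [P (tag q)] to the [P (x t)], which send [Rad^(level q)] into [Rad^(j+1)] and so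
     descend to the quotients. *)
  have [c cE] := @dsum_map _ _ (fun t => P (x t)) X (fun t => quo_map _).
  have [v|k kE] := @projP (tag q) _ _ c (psi \o (g \o pr q)).
    have [w wE] := fin_all_exists (fun t => quo_map_surj (v t)).
    by exists w; apply: dsumP => t; rewrite cE; apply: wE.
  have mP t : exists m : {linear quo_rad P q -> quo_rad P (p t)},
      forall y, m (pr q y) = pr (p t) (k y t).
    apply: (@quo_lift _ _ _ _ (pr (p t) \o (@dsum_proj _ _ _ t \o k))) => z zq.
    apply/eqP; rewrite quo_map_eq0; apply: radn_sub lt_jq _ _.
    exact: (radn_image (@dsum_proj _ _ _ t \o k)).
  have [m mE] := fin_all_exists mP.
  exists (fun t => m t \o @dsum_proj _ _ (quo_rad P (l := l)) q : PR P (p t)) => u.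
  have [z zE] := quo_map_surj (u q); apply: dsumP => t.
  rewrite a0u /= /dsum_proj -zE mE (rP t).1 -cE kE.
  by [].
- move=> y; have yP t := quo_map_surj (y t).
  have [e eE] := fin_all_exists yP; exists e; apply: dsumP => t.
  by rewrite bE; apply: eE.
move=> e.
split=> [|be0].
  move=> /eqP; rewrite quo_map_eq0 in_preim_submod => /LHom_submodP esoc.
  apply: dsumP => t; rewrite bE; apply/eqP; rewrite quo_map_eq0 trace_PR_rad.
  apply/LHom_submodP => u; apply/(rP t).2; rewrite -a0u.
  have /psi_ker -> // : val (a0 e u) \in socn V j.
  by have := esoc u; rewrite /= a1E.
apply/eqP; rewrite quo_map_eq0 in_preim_submod; apply/LHom_submodP => u.
rewrite /= a1E; apply/psi_ker/dsumP => t; rewrite a0u; apply/(rP t).2.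
move: u; apply/LHom_submodP; rewrite -trace_PR_rad -quo_map_eq0; apply/eqP.
by rewrite -(bE e t) be0.
Qed.
End SocleLayer.

End ADRModules.

Theorem lemma4p3
  (k : comNzRingType) (A : algType k) (artA : artin_algebra A)
  (n : nat) (P : 'I_n -> lmodType A) (hP : complete_proj_indec P)
  (l : 'I_n -> nat) (hl : forall i, is_loewy_length (P i) (l i))
  (M : lmodType A) (hM : fin_gen M) (j : nat) (hj : (1 <= j)%N) :
  (LHom_submod (Gmod P l) (socn M j) =i
     trace (dsum (fun p : {p : Lam l | (level p <= j)%N} => PR P (val p)))
           (HomG P l M)) /\
  (forall (Theta : finType) (x : Theta -> 'I_n),
     iso (subquo (socn M j) (socn M j.-1)) (dsum (fun t => top (P (x t)))) ->
     exists2 p : Theta -> Lam l,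
       forall t, tag (p t) = x t /\ level (p t) = j &
       iso (subquo (LHom_submod (Gmod P l) (socn M j))
                   (LHom_submod (Gmod P l) (socn M j.-1)))
           (dsum (fun t => Delta P (p t)))).
Proof.
have [genproj neqP _] := hP.
have dccP i : dcc (P i) by apply: artin_algebra_dcc artA _; case: (genproj i).
have projP i : projective (P i) by case: (genproj i).
have indecP i : indecomposable (P i) by case: (genproj i).
split=> [f|]; first exact: LHom_socn_trace.
(* The layer results are indexed by the predecessor of the socle index. *)
case: j hj => // j _ Theta x /subquo_iso[psi [psi_surj psi_ker]].
exists (layer_index dccP projP indecP hl psi_surj psi_ker) => //.
exact: LHom_socle_layer.
Qed.
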